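(* Let $k\ge 4$, let $f_1(x),\dots,f_{k-1}(x)$ be smooth nowhere vanishing functions on an open interval $I\ni x_0$, let $g(x,t)$ be a given function, and suppose that there are functions $g_{i:k-1}(x,t)$ ($2\le i\le k-2$), $R_{f_{k-1}}(x,t)$, $G(x,t)$ with $$\partial_xG=g,\qquad f_{k-1}\,\partial_xR_{f_{k-1}}=G,\qquad f_{k-2}\,\partial_xg_{k-2:k-1}=R_{f_{k-1}},\qquad f_i\,\partial_xg_{i:k-1}=g_{i+1:k-1}\ (2\le i\le k-3).$$ If, for each fixed $t$, the function $g_{2:k-1}(x,t)\frac1{f_1(x)}$ of $x$ satisfies Liouville's condition, then $$\bar u_{k-1}(x,t)=\int_{x_0}^x\frac{g_{2:k-1}(s,t)}{f_1(s)}\,ds$$ is a particular solution, elementary with respect to $x$, of the equation $$\partial_x f_{k-1}\partial_x f_{k-2}\partial_x\cdots\partial_x f_2\partial_x f_1\partial_x u=g(x,t).$$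
   Context: Liouville's condition for a function $h(x)$: there exist $n$, constants $c_1,\dots,c_n\in\mathbb{C}$ and elementary functions $h_1,\dots,h_n$ (nowhere zero on $I$) and $s$ such that $h(x)=\sum_{i=1}^n c_i\frac{h_i'(x)}{h_i(x)}+s'(x)$ on $I$. Elementary functions: one considers differential fields whose elements are complex-valued functions of the real variable $x$ on a suitable open interval $I$ with derivation $d/dx$, starting from the field $\mathbb{C}(x)$ of rational functions (all fields can be taken inside the field of quotients of complex-valued real-analytic functions on $I$; the functions occurring in the statement are assumed defined and smooth in $x$ on $I$). A simple extension $K\subset K(g)$ is called elementary if it is exponential ($g'=s'g$ for some $s\in K$), or logarithmic ($g'=s'/s$ for some nonzero $s\in K$), or algebraic ($g$ is a root of an irreducible polynomial over $K$). A function is elementary if it belongs to the last field of a finite chain $\mathbb{C}(x)\subset K_1\subset\dots\subset K_r$ of elementary extensions. A function of $(x,t)$ is elementary with respect to $x$ if it is an elementary function of $x$ for each fixed $t$. *)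

(* Defs.v *)
From Stdlib Require Import Reals Lra Lia ClassicalEpsilon.
From Coquelicot Require Import Coquelicot.
From HB Require Import structures.
From mathcomp Require Import all_boot all_algebra.
From mathcomp Require Import boolp.
Import GRing.Theory.

Set Implicit Arguments.
Unset Strict Implicit.
Unset Printing Implicit Defensive.

Delimit Scope R_scope with coqR.
Local Open Scope R_scope.
Local Open Scope C_scope.

Record ointerval := OInterval
  { lower : Rbar; upper : Rbar; lower_lt_upper : Rbar_lt lower upper }.

Definition in_itv (I : ointerval) (x : R) : Prop :=
  Rbar_lt (lower I) x /\ Rbar_lt x (upper I).

Coercion in_itv : ointerval >-> Funclass.

Lemma in_itv_dec (I : ointerval) (x : R) : {I x} + {~ I x}.
Proof. exact: excluded_middle_informative. Qed.

Lemma itv_nonempty (I : ointerval) : exists x : R, I x.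
Proof.
case: I => [[a| |] [b| |]] //= ab; rewrite /in_itv /=.
- by exists ((a + b) / 2)%coqR; lra.
- by exists (a + 1)%coqR; split=> //; lra.
- by exists (b - 1)%coqR; split=> //; lra.
- by exists 0%coqR.
Qed.

Lemma itv_locally (I : ointerval) (x : R) : I x -> locally x (fun y : R => I y).
Proof. by case=> H1 H2; exact: (locally_interval _ _ _ _ H1 H2). Qed.

Lemma itv_convex (I : ointerval) (x y z : R) :
  I x -> I y -> (x <= z <= y)%coqR -> I z.
Proof.
case: I => a b ab [/= Ha _] [/= _ Hb] [Hxz Hzy]; split=> /=.
- exact: (Rbar_lt_le_trans a x z Ha Hxz).
- exact: (Rbar_le_lt_trans z y b Hzy Hb).
Qed.

(* Complex-valued functions of a real variable: the derivative is taken in C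
   as a real normed space, i.e. componentwise. *)
Notation is_dx f x l :=
  (@is_derive R_AbsRing C_R_NormedModule f x l) (only parsing).

Definition dx (f : R -> C) (x : R) : C :=
  (Derive (fun y => Re (f y)) x, Derive (fun y => Im (f y)) x).

Definition smooth_on (I : ointerval) (f : R -> C) : Prop :=
  forall (n : nat) (x : R), I x ->
    @ex_derive R_AbsRing C_R_NormedModule (Nat.iter n dx f) x.

Definition analytic_at (f : R -> C) (c : R) : Prop :=
  exists a : nat -> C, locally c (fun x : R =>
    @is_pseries R_AbsRing C_R_NormedModule a (x - c)%coqR (f x)).

Lemma is_dx_components (f : R -> C) (x : R) (l : C) :
  is_dx f x l <->
  is_derive (fun y => Re (f y)) x (Re l) /\ is_derive (fun y => Im (f y)) x (Im l).
Proof.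
split.
- move=> H; split.
  + apply: (@filterdiff_comp' R_AbsRing R_NormedModule C_R_NormedModule R_NormedModule
      f fst x _ fst H).
    apply: filterdiff_linear; exact: is_linear_fst.
  + apply: (@filterdiff_comp' R_AbsRing R_NormedModule C_R_NormedModule R_NormedModule
      f snd x _ snd H).
    apply: filterdiff_linear; exact: is_linear_snd.
- case=> H1 H2; rewrite /is_derive.
  have H := @filterdiff_comp'_2 R_AbsRing R_NormedModule R_NormedModule R_NormedModule
    C_R_NormedModule _ _ (fun a b => (a, b) : C) x _ _ (fun a b => (a, b) : C) H1 H2.
  apply: (filterdiff_ext_lin _ (fun y : R => (scal y (Re l), scal y (Im l)) : C)).
  + apply: (filterdiff_ext (fun y => (Re (f y), Im (f y)) : C)).
      by move=> y; case: (f y).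
    apply: H.
    apply: (filterdiff_ext_lin _ (fun t : prod_NormedModule R_AbsRing R_NormedModule R_NormedModule => t)).
      apply: (filterdiff_ext (fun t : prod_NormedModule R_AbsRing R_NormedModule R_NormedModule => t)).
        by case.
      exact: filterdiff_id.
    by case.
  + by [].
Qed.

Lemma dx_unique (f : R -> C) (x : R) (l : C) : is_dx f x l -> dx f x = l.
Proof.
move/is_dx_components=> [H1 H2]; rewrite /dx.
by rewrite (is_derive_unique _ _ _ H1) (is_derive_unique _ _ _ H2); destruct l.
Qed.

Lemma dx_correct (f : R -> C) (x : R) :
  @ex_derive R_AbsRing C_R_NormedModule f x -> is_dx f x (dx f x).
Proof. by case=> l H; rewrite (dx_unique H). Qed.

Lemma dx_ext_loc (f g : R -> C) (x : R) :
  locally x (fun y : R => f y = g y) -> dx f x = dx g x.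
Proof.
by move=> H; rewrite /dx; congr pair; apply: Derive_ext_loc;
  apply: filter_imp H => y ->.
Qed.

Definition real_analytic_at (f : R -> R) (c : R) : Prop :=
  exists a : nat -> R, locally c (fun x : R => is_pseries a (x - c)%coqR (f x)).

Lemma is_pseries_components (a : nat -> C) (x : R) (l : C) :
  @is_pseries R_AbsRing C_R_NormedModule a x l <->
  is_pseries (fun n => Re (a n)) x (Re l) /\ is_pseries (fun n => Im (a n)) x (Im l).
Proof.
have E n : sum_n (fun k => @scal R_AbsRing C_R_NormedModule (pow_n x k) (a k)) n =
  (sum_n (fun k => scal (pow_n x k) (Re (a k))) n,
   sum_n (fun k => scal (pow_n x k) (Im (a k))) n).
  elim: n => [|n IHn]; first by rewrite !sum_O.
  by rewrite !sum_Sn IHn.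
rewrite /is_pseries /is_series; split.
- move=> H; split.
  + apply: (filterlim_ext (fun n => fst (sum_n (fun k => @scal R_AbsRing C_R_NormedModule (pow_n x k) (a k)) n))).
      by move=> n; rewrite E.
    apply: (filterlim_comp _ _ _ _ _ _ _ _ H).
    case: l {H} => l1 l2; exact: continuous_fst.
  + apply: (filterlim_ext (fun n => snd (sum_n (fun k => @scal R_AbsRing C_R_NormedModule (pow_n x k) (a k)) n))).
      by move=> n; rewrite E.
    apply: (filterlim_comp _ _ _ _ _ _ _ _ H).
    case: l {H} => l1 l2; exact: continuous_snd.
- case=> /filterlim_locally H1 /filterlim_locally H2.
  apply/filterlim_locally => eps.
  apply: filter_imp (filter_and _ _ (H1 eps) (H2 eps)) => n; rewrite E.
  by case.
Qed.

Lemma analytic_components (f : R -> C) (c : R) :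
  analytic_at f c <-> real_analytic_at (fun x => Re (f x)) c /\ real_analytic_at (fun x => Im (f x)) c.
Proof.
split.
- case=> a H; split.
  + exists (fun n => Re (a n)); apply: filter_imp H => x.
    by case/is_pseries_components.
  + exists (fun n => Im (a n)); apply: filter_imp H => x.
    by case/is_pseries_components.
- case=> -[a Ha] [b Hb]; exists (fun n => (a n, b n)).
  apply: filter_imp (filter_and _ _ Ha Hb) => x Hx.
  exact/is_pseries_components.
Qed.

Lemma CV_radius_ge (a : nat -> R) (x : R) :
  ex_pseries a x -> Rbar_le (Rabs x) (CV_radius a).
Proof.
move=> H; case: (Rbar_le_lt_dec (Rabs x) (CV_radius a)) => // Hlt.
exfalso; apply: (CV_disk_outside _ _ Hlt).
by apply: ex_series_lim_0; apply/ex_pseries_R.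
Qed.

Lemma real_analytic_spec (f : R -> R) (c : R) : real_analytic_at f c ->
  exists (a : nat -> R) (r : posreal),
    Rbar_le r (CV_radius a) /\
    forall x, (Rabs (x - c) < r)%coqR -> f x = PSeries a (x - c)%coqR.
Proof.
case=> a [r Hr]; exists a, (mkposreal (r / 2) (is_pos_div_2 r)) => /=; split.
- have Hp := cond_pos r.
  rewrite -(Rabs_pos_eq (r / 2)%coqR); last by lra.
  apply: CV_radius_ge; exists (f (c + r / 2)%coqR).
  have E : (c + r / 2 - c)%coqR = (r / 2)%coqR by lra.
  rewrite -{1}E; apply: Hr; change (Rabs (c + r / 2 - c) < r)%coqR.
  by rewrite E Rabs_pos_eq; lra.
- move=> x Hx; symmetry; apply: is_pseries_unique; apply: Hr.
  change (Rabs (x - c) < r)%coqR; have := cond_pos r; lra.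
Qed.

Lemma real_analytic_intro (f : R -> R) (c : R) (a : nat -> R) (r : posreal) :
  Rbar_le r (CV_radius a) ->
  (forall x, (Rabs (x - c) < r)%coqR -> f x = PSeries a (x - c)%coqR) -> real_analytic_at f c.
Proof.
move=> Hr H; exists a, r => x Hx; rewrite H //.
apply: PSeries_correct; apply: CV_radius_inside.
by apply: Rbar_lt_le_trans Hr.
Qed.

Lemma real_analytic_ext_loc (f g : R -> R) (c : R) :
  locally c (fun x : R => f x = g x) -> real_analytic_at f c -> real_analytic_at g c.
Proof.
move=> H [a Ha]; exists a.
by apply: filter_imp (filter_and _ _ H Ha) => x [<-].
Qed.

Lemma real_analytic_plus (f g : R -> R) (c : R) :
  real_analytic_at f c -> real_analytic_at g c -> real_analytic_at (fun x => f x + g x)%coqR c.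
Proof.
case=> a Ha [b Hb]; exists (PS_plus a b).
by apply: filter_imp (filter_and _ _ Ha Hb) => x [H1 H2]; exact: is_pseries_plus.
Qed.

Lemma real_analytic_opp (f : R -> R) (c : R) : real_analytic_at f c -> real_analytic_at (fun x => - f x)%coqR c.
Proof.
case=> a Ha; exists (PS_opp a).
by apply: filter_imp Ha => x; exact: is_pseries_opp.
Qed.

Lemma real_analytic_mult (f g : R -> R) (c : R) :
  real_analytic_at f c -> real_analytic_at g c -> real_analytic_at (fun x => f x * g x)%coqR c.
Proof.
case/real_analytic_spec=> a [r [Hr Ha]] /real_analytic_spec [b [s [Hs Hb]]].
exists (PS_mult a b).
have Hm : (0 < Rmin r s)%coqR by apply: Rmin_pos; exact: cond_pos.
exists (mkposreal _ Hm) => x /= Hx.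
have Hx' : (Rabs (x - c) < Rmin r s)%coqR by exact: Hx.
have H1 : (Rabs (x - c) < r)%coqR by apply: (Rlt_le_trans _ _ _ Hx'); exact: Rmin_l.
have H2 : (Rabs (x - c) < s)%coqR by apply: (Rlt_le_trans _ _ _ Hx'); exact: Rmin_r.
have H1' : Rbar_lt (Rabs (x - c)) (CV_radius a) by apply: Rbar_lt_le_trans Hr.
have H2' : Rbar_lt (Rabs (x - c)) (CV_radius b) by apply: Rbar_lt_le_trans Hs.
rewrite Ha // Hb //.
by apply: is_pseries_mult => //; apply: PSeries_correct; exact: CV_radius_inside.
Qed.

Lemma real_analytic_const (k c : R) : real_analytic_at (fun _ => k) c.
Proof.
exists (fun n => if n is 0%nat then k else 0%coqR); apply: filter_forall => x.
apply/is_pseries_R; apply: (is_series_ext (fun n => if n is 0%nat then k else 0%coqR)).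
  by case=> [|n] /=; ring.
apply: (filterlim_ext (fun _ => k)); last exact: filterlim_const.
elim=> [|n IHn]; first by rewrite sum_O.
by rewrite sum_Sn -IHn; symmetry; exact: Rplus_0_r.
Qed.

Lemma real_analytic_id (c : R) : real_analytic_at (fun x => x) c.
Proof.
exists (fun n => match n with 0%nat => c | 1%nat => 1%coqR | _ => 0%coqR end).
apply: filter_forall => x.
apply/is_pseries_R.
pose u n := match n with 0%nat => c | 1%nat => (x - c)%coqR | _ => 0%coqR end.
apply: (is_series_ext u).
  by case=> [|[|n]] /=; rewrite /u; ring.
apply: (filterlim_ext_loc (fun _ => x)); last exact: filterlim_const.
exists 1%nat; case=> [/Nat.nle_succ_0 //|n _].
elim: n => [|n IHn]; first by rewrite sum_Sn sum_O /u /plus /=; ring.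
by rewrite sum_Sn -IHn; symmetry; exact: Rplus_0_r.
Qed.

Lemma real_analytic_is_derive (f : R -> R) (c : R) : real_analytic_at f c ->
  exists b : nat -> R, locally c (fun x : R =>
    is_derive f x (PSeries b (x - c)%coqR) /\
    is_pseries b (x - c)%coqR (PSeries b (x - c)%coqR)).
Proof.
case/real_analytic_spec=> a [r [Hr Ha]]; exists (PS_derive a), r => x Hx.
have Hx' : Rbar_lt (Rabs (x - c)) (CV_radius a) by apply: Rbar_lt_le_trans Hr.
split; last first.
  by apply: PSeries_correct; apply: CV_radius_inside; rewrite CV_radius_derive.
apply: (is_derive_ext_loc (fun y => PSeries a (y - c)%coqR)).
  have : locally x (ball c r).
    have Hx0 : (Rabs (x - c) < r)%coqR by exact: Hx.
    have Hd : (0 < r - Rabs (x - c))%coqR by lra.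
    exists (mkposreal _ Hd) => y Hy.
    have Hy0 : (Rabs (y - x) < r - Rabs (x - c))%coqR by exact: Hy.
    change (Rabs (y - c) < r)%coqR.
    have := Rabs_triang (y - x) (x - c); replace (y - x + (x - c))%coqR with (y - c)%coqR by lra.
    lra.
  by apply: filter_imp => y Hy; rewrite Ha.
rewrite -(Rmult_1_l (PSeries _ _)).
apply: (is_derive_comp (PSeries a) (fun y => y - c)%coqR x); last first.
  by auto_derive => //; ring.
exact: is_derive_PSeries.
Qed.

Lemma real_analytic_ex_derive (f : R -> R) (c : R) : real_analytic_at f c -> ex_derive f c.
Proof.
by case/real_analytic_is_derive=> b /locally_singleton [H _]; eexists; exact: H.
Qed.

Lemma real_analytic_derive (f : R -> R) (c : R) : real_analytic_at f c -> real_analytic_at (Derive f) c.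
Proof.
case/real_analytic_is_derive=> b H; exists b; apply: filter_imp H => x [H1 H2].
by rewrite (is_derive_unique _ _ _ H1).
Qed.

Lemma real_analytic_dichotomy (f : R -> R) (c : R) : real_analytic_at f c ->
  locally c (fun x : R => f x = 0%coqR) \/
  locally c (fun x : R => x <> c -> f x <> 0%coqR).
Proof.
case/real_analytic_spec=> a [r [Hr Ha]].
case: (pselect (exists n, a n <> 0%coqR)) => [Hex|Hno]; last first.
  left; exists r => x Hx; rewrite Ha //.
  rewrite (PSeries_ext _ (fun _ => 0%coqR)) ?PSeries_const_0 // => n.
  by case: (Req_dec (a n) 0) => // Hn; case: Hno; exists n.
right.
have Hex' : exists n, `[< a n <> 0%coqR >] by case: Hex => n Hn; exists n; apply/asboolP.
case: (ex_minnP Hex') => m /asboolP Hm Hmin.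
have H0 k : (k < m)%coq_nat -> a k = 0%coqR.
  move=> /ltP Hk; case: (Req_dec (a k) 0) => // /asboolP Hn.
  by move: (Hmin _ Hn); rewrite leqNgt Hk.
have Hrd : Rbar_lt (Rabs 0) (CV_radius (PS_decr_n a m)).
  have Hp := cond_pos r; rewrite Rabs_R0.
  apply: (Rbar_lt_le_trans _ (Rabs (r / 2))).
    by rewrite Rabs_pos_eq /=; lra.
  apply: CV_radius_ge; apply: ex_pseries_decr_n.
    by right; exists (/ (r / 2))%coqR; apply: Rinv_l; lra.
  apply: CV_radius_inside; apply: Rbar_lt_le_trans Hr.
  by rewrite Rabs_pos_eq /=; lra.
have Hcont : continuous (PSeries (PS_decr_n a m)) 0%coqR.
  by apply/continuity_pt_filterlim; exact: PSeries_continuity.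
have Hne : PSeries (PS_decr_n a m) 0 <> 0%coqR.
  by rewrite PSeries_0 /PS_decr_n Nat.add_0_r.
have Hloc : locally 0%coqR (fun y : R => PSeries (PS_decr_n a m) y <> 0%coqR).
  by apply: (Hcont (fun z : R => z <> 0%coqR)); exact: open_neq.
case: Hloc => s Hs.
have Hp : (0 < Rmin r s)%coqR by apply: Rmin_pos; exact: cond_pos.
exists (mkposreal _ Hp) => x Hx Hxc.
have Hx' : (Rabs (x - c) < Rmin r s)%coqR by exact: Hx.
rewrite Ha; last by apply: (Rlt_le_trans _ _ _ Hx'); exact: Rmin_l.
rewrite (PSeries_decr_n_aux a m) //.
apply: Rmult_integral_contrapositive_currified.
  by apply: pow_nonzero; lra.
apply: Hs; change (Rabs (x - c - 0) < s)%coqR.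
by rewrite Rminus_0_r; apply: (Rlt_le_trans _ _ _ Hx'); exact: Rmin_r.
Qed.

Lemma real_analytic_identity (I : ointerval) (f : R -> R) (x1 : R) :
  (forall x, I x -> real_analytic_at f x) -> I x1 -> locally x1 (fun x : R => f x = 0%coqR) ->
  forall x, I x -> f x = 0%coqR.
Proof.
move=> Hf I1 H1.
pose P c := locally c (fun x : R => f x = 0%coqR).
pose phi (c : R) : R := if pselect (P c) then 1%coqR else 0%coqR.
have phi1 c : P c -> phi c = 1%coqR by rewrite /phi; case: pselect.
have phi0 c : ~ P c -> phi c = 0%coqR by rewrite /phi; case: pselect.
have D c : I c -> is_derive phi c zero.
  move=> Ic; apply: (is_derive_ext_loc (fun _ => phi c)); last exact: is_derive_const.
  case: (pselect (P c)) => Pc.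
    apply: filter_imp (locally_locally _ _ Pc) => y Py.
    by rewrite (phi1 _ Pc) phi1.
  case: (real_analytic_dichotomy (Hf _ Ic)) => [//|Hne].
  apply: filter_imp Hne => y Hy; rewrite (phi0 _ Pc).
  case: (Req_dec y c) => [->|yc]; first by rewrite phi0.
  rewrite phi0 // => /locally_singleton; exact: Hy.
move=> x Ix.
have E : phi x1 = phi x.
  case: (Rtotal_order x1 x) => [lt|[-> //|lt]].
  - apply: eq_is_derive lt => t Ht; apply: D; exact: (itv_convex I1 Ix Ht).
  - symmetry; apply: eq_is_derive lt => t Ht; apply: D; exact: (itv_convex Ix I1 Ht).
apply: (locally_singleton x (fun x : R => f x = 0%coqR)).
case: (pselect (P x)) => // nP.
by move: E; rewrite phi1 // phi0 // => /R1_neq_R0.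
Qed.

Lemma analytic_plus (f g : R -> C) (c : R) :
  analytic_at f c -> analytic_at g c -> analytic_at (fun x => f x + g x) c.
Proof.
move=> /analytic_components [f1 f2] /analytic_components [g1 g2].
by apply/analytic_components; split; apply: real_analytic_plus.
Qed.

Lemma analytic_opp (f : R -> C) (c : R) :
  analytic_at f c -> analytic_at (fun x => - f x) c.
Proof.
move=> /analytic_components [f1 f2].
by apply/analytic_components; split; apply: real_analytic_opp.
Qed.

Lemma analytic_mult (f g : R -> C) (c : R) :
  analytic_at f c -> analytic_at g c -> analytic_at (fun x => f x * g x) c.
Proof.
move=> /analytic_components [f1 f2] /analytic_components [g1 g2].
apply/analytic_components; split.
- apply: real_analytic_plus; first exact: real_analytic_mult.
  by apply: real_analytic_opp; exact: real_analytic_mult.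
- by apply: real_analytic_plus; exact: real_analytic_mult.
Qed.

Lemma analytic_const (k : C) (c : R) : analytic_at (fun _ => k) c.
Proof. by apply/analytic_components; split; apply: real_analytic_const. Qed.

Lemma analytic_id (c : R) : analytic_at (fun x => RtoC x) c.
Proof.
apply/analytic_components; split; first exact: real_analytic_id.
exact: real_analytic_const.
Qed.

Lemma analytic_ex_derive (f : R -> C) (c : R) :
  analytic_at f c -> @ex_derive R_AbsRing C_R_NormedModule f c.
Proof.
move=> /analytic_components [/real_analytic_ex_derive [l1 H1] /real_analytic_ex_derive [l2 H2]].
by exists (l1, l2); apply/is_dx_components.
Qed.

Lemma analytic_dx (f : R -> C) (c : R) : analytic_at f c -> analytic_at (dx f) c.
Proof.
move=> /analytic_components [f1 f2].
by apply/analytic_components; split; apply: real_analytic_derive.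
Qed.

Lemma analytic_ext_loc (f g : R -> C) (c : R) :
  locally c (fun x : R => f x = g x) -> analytic_at f c -> analytic_at g c.
Proof.
move=> H [a Ha]; exists a.
by apply: filter_imp (filter_and _ _ H Ha) => x [<-].
Qed.

Lemma analytic_integral (I : ointerval) (f g : R -> C) :
  (forall x, I x -> analytic_at f x) -> (forall x, I x -> analytic_at g x) ->
  (forall x, I x -> f x * g x = 0) ->
  (forall x, I x -> f x = 0) \/ (forall x, I x -> g x = 0).
Proof.
move=> Hf Hg Hfg.
case: (pselect (forall x, I x -> f x = 0)) => [|nf]; [by left | right].
have [x1 [I1 fx1]] : exists x, I x /\ f x <> 0.
  apply: NNPP => nex; apply: nf => x Ix; apply: NNPP => fx.
  by apply: nex; exists x.
have Lf : locally x1 (fun x : R => f x <> 0).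
  have /analytic_components [/real_analytic_ex_derive /ex_derive_continuous H1
    /real_analytic_ex_derive /ex_derive_continuous H2] := Hf _ I1.
  case: (Req_dec (Re (f x1)) 0) => [r0|r0].
  - have i0 : Im (f x1) <> 0%coqR.
      by move=> i0; apply: fx1; apply: injective_projections.
    have : locally x1 (fun x : R => Im (f x) <> 0%coqR).
      by apply: (H2 (fun z : R => z <> 0%coqR)); exact: open_neq.
    by apply: filter_imp => x Hx fx; apply: Hx; rewrite fx.
  - have : locally x1 (fun x : R => Re (f x) <> 0%coqR).
      by apply: (H1 (fun z : R => z <> 0%coqR)); exact: open_neq.
    by apply: filter_imp => x Hx fx; apply: Hx; rewrite fx.
have Lg : locally x1 (fun x : R => g x = 0).
  apply: filter_imp (filter_and _ _ Lf (itv_locally I1)) => x [fx Ix].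
  by apply: NNPP => gx; apply: (Cmult_neq_0 _ _ fx gx); exact: Hfg.
move=> x Ix; apply: injective_projections.
- apply: (@real_analytic_identity I (fun x => Re (g x)) x1) => //.
  + by move=> y /Hg /analytic_components [].
  + by apply: filter_imp Lg => y ->.
- apply: (@real_analytic_identity I (fun x => Im (g x)) x1) => //.
  + by move=> y /Hg /analytic_components [].
  + by apply: filter_imp Lg => y ->.
Qed.

(* Analytic functions on I, normalised to vanish outside I so that Leibniz
   equality is equality on I. *)
Record anfun (I : ointerval) := Anfun
  { anfun_val :> R -> C;
    anfun_analytic : forall x, I x -> analytic_at anfun_val x;
    anfun_out : forall x, ~ I x -> anfun_val x = 0 }.

HB.instance Definition _ (I : ointerval) := gen_eqMixin (anfun I).
HB.instance Definition _ (I : ointerval) := gen_choiceMixin (anfun I).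

Lemma anfun_eq (I : ointerval) (f g : anfun I) :
  (forall x, I x -> f x = g x) -> f = g.
Proof.
case: f g => f f1 f2 [g g1 g2] /= H.
have E : f = g.
  apply: functional_extensionality_dep => x.
  by case: (in_itv_dec I x) => Ix; [exact: H | rewrite f2 // g2].
by subst g; f_equal; exact: Prop_irrelevance.
Qed.

Definition restr (I : ointerval) (f : R -> C) (x : R) : C :=
  if in_itv_dec I x then f x else 0.

Lemma restr_in (I : ointerval) (f : R -> C) (x : R) : I x -> restr I f x = f x.
Proof. by rewrite /restr; case: in_itv_dec. Qed.

Lemma restr_out (I : ointerval) (f : R -> C) (x : R) : ~ I x -> restr I f x = 0.
Proof. by rewrite /restr; case: in_itv_dec. Qed.

Lemma restr_analytic (I : ointerval) (f : R -> C) :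
  (forall x, I x -> analytic_at f x) -> forall x, I x -> analytic_at (restr I f) x.
Proof.
move=> H x Ix; apply: analytic_ext_loc (H _ Ix).
by apply: filter_imp (itv_locally Ix) => y Iy; rewrite restr_in.
Qed.

Definition mk_anfun (I : ointerval) (f : R -> C)
    (H : forall x, I x -> analytic_at f x) : anfun I :=
  Anfun (restr_analytic H) (@restr_out I f).

Section AnalyticRing.
Variable I : ointerval.
Implicit Types f g h : anfun I.

Definition an_const (c : C) : anfun I := mk_anfun (fun x _ => analytic_const c x).

Definition an_x : anfun I := mk_anfun (fun x _ => analytic_id x).

Definition an_add f g : anfun I := mk_anfun
  (fun x Ix => analytic_plus (anfun_analytic f Ix) (anfun_analytic g Ix)).

Definition an_opp f : anfun I :=
  mk_anfun (fun x Ix => analytic_opp (anfun_analytic f Ix)).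

Definition an_mul f g : anfun I := mk_anfun
  (fun x Ix => analytic_mult (anfun_analytic f Ix) (anfun_analytic g Ix)).

Definition an_dx f : anfun I :=
  mk_anfun (fun x Ix => analytic_dx (anfun_analytic f Ix)).

Local Ltac an_ring :=
  repeat (let f := fresh in intro f);
  apply: anfun_eq => ? ?; rewrite /= !restr_in //; ring.

Lemma an_addA : associative an_add. Proof. by an_ring. Qed.
Lemma an_addC : commutative an_add. Proof. by an_ring. Qed.
Lemma an_add0 : left_id (an_const 0) an_add. Proof. by an_ring. Qed.
Lemma an_addN : left_inverse (an_const 0) an_opp an_add. Proof. by an_ring. Qed.
Lemma an_mulA : associative an_mul. Proof. by an_ring. Qed.
Lemma an_mulC : commutative an_mul. Proof. by an_ring. Qed.
Lemma an_mul1 : left_id (an_const 1) an_mul. Proof. by an_ring. Qed.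
Lemma an_mulD : left_distributive an_mul an_add. Proof. by an_ring. Qed.

HB.instance Definition _ :=
  GRing.isZmodule.Build (anfun I) an_addA an_addC an_add0 an_addN.

Lemma an_1_neq0 : an_const 1 != 0%R.
Proof.
apply/eqP => H; have [x Ix] := itv_nonempty I.
have : an_const 1 x = an_const 0 x by rewrite H.
by rewrite /= !restr_in // => -[] /R1_neq_R0.
Qed.

HB.instance Definition _ := GRing.Zmodule_isComNzRing.Build (anfun I)
  an_mulA an_mulC an_mul1 an_mulD an_1_neq0.

Definition an_unit : pred (anfun I) := fun f => `[< exists g, (g * f = 1)%R >].

Definition an_inv f : anfun I :=
  if pselect (exists g, (g * f = 1)%R) is left H then projT1 (cid H) else f.

Lemma an_mulV : {in an_unit, left_inverse 1%R an_inv *%R}.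
Proof.
move=> f /asboolP H; rewrite /an_inv; case: pselect => // H'.
exact: (projT2 (cid H')).
Qed.

Lemma an_unitP f g : (g * f = 1)%R -> an_unit f.
Proof. by move=> H; apply/asboolP; exists g. Qed.

Lemma an_inv_out : {in [predC an_unit], an_inv =1 id}.
Proof.
move=> f; rewrite inE => /asboolP H; rewrite /an_inv; by case: pselect.
Qed.

HB.instance Definition _ := GRing.ComNzRing_hasMulInverse.Build (anfun I)
  an_mulV an_unitP an_inv_out.

Lemma an_integral : GRing.integral_domain_axiom (anfun I).
Proof.
move=> f g fg.
have H x : I x -> (f x * g x = 0)%C.
  move=> Ix; have : (f * g)%R x = an_const 0 x by rewrite fg.
  by rewrite /= !restr_in.
have Z h : (forall x, I x -> h x = 0) -> h = 0%R.
  by move=> Hh; apply: anfun_eq => x Ix; rewrite Hh //= restr_in.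
case: (analytic_integral (@anfun_analytic I f) (@anfun_analytic I g) H) => /Z ->;
  by rewrite eqxx ?orbT.
Qed.

HB.instance Definition _ := GRing.ComUnitRing_isIntegral.Build (anfun I) an_integral.

End AnalyticRing.

Lemma is_dx_mult (f g : R -> C) (x : R) (l m : C) :
  is_dx f x l -> is_dx g x m -> is_dx (fun y => f y * g y) x (l * g x + f x * m).
Proof.
move=> /is_dx_components [f1 f2] /is_dx_components [g1 g2].
have M (u v : R -> R) (du dv : R) : is_derive u x du -> is_derive v x dv ->
    is_derive (fun y => u y * v y)%coqR x (du * v x + u x * dv)%coqR.
  by move=> Hu Hv; apply: (is_derive_mult u v x du dv Hu Hv Rmult_comm).
apply/is_dx_components; split.
- have H := is_derive_minus _ _ _ _ _ (M _ _ _ _ f1 g1) (M _ _ _ _ f2 g2).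
  apply: (eq_ind _ (fun d => is_derive _ x d) H).
  change ((Re l * Re (g x) + Re (f x) * Re m) - (Im l * Im (g x) + Im (f x) * Im m) =
    (Re l * Re (g x) - Im l * Im (g x)) + (Re (f x) * Re m - Im (f x) * Im m))%coqR.
  ring.
- have H := is_derive_plus _ _ _ _ _ (M _ _ _ _ f1 g2) (M _ _ _ _ f2 g1).
  apply: (eq_ind _ (fun d => is_derive _ x d) H).
  change ((Re l * Im (g x) + Re (f x) * Im m) + (Im l * Re (g x) + Im (f x) * Re m) =
    (Re l * Im (g x) + Im l * Re (g x)) + (Re (f x) * Im m + Im (f x) * Re m))%coqR.
  ring.
Qed.

Lemma an_dx_mul (I : ointerval) (f g : anfun I) :
  an_dx (f * g)%R = (an_dx f * g + f * an_dx g)%R.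
Proof.
apply: anfun_eq => x Ix; rewrite /= !restr_in //.
have -> : dx (restr I (fun y => f y * g y)) x = dx (fun y => f y * g y) x.
  apply: dx_ext_loc; apply: filter_imp (itv_locally Ix) => y Iy.
  by rewrite restr_in.
by apply: dx_unique; apply: is_dx_mult; apply: dx_correct;
  apply: analytic_ex_derive; apply: anfun_analytic.
Qed.

(* Quotients of complex-valued real-analytic functions on I. *)
Notation mero I := {fraction (anfun I)}.

Definition an_frac (I : ointerval) (a : anfun I) : mero I :=
  @FracField.tofrac (anfun I) a.

Definition mero_dx (I : ointerval) (q : mero I) : mero I :=
  let n := \n_(repr q) in
  let d := \d_(repr q) in
  (an_frac (an_dx n * d - n * an_dx d)%R / an_frac d ^+ 2)%R.

From mathcomp Require Import ring.

Lemma mero_repr (I : ointerval) (q : mero I) :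
  q = (an_frac \n_(repr q) / an_frac \d_(repr q))%R.
Proof.
rewrite /an_frac -[LHS]reprK -[X in (\pi X)%qT]Ratio_numden; unlock FracField.tofrac.
rewrite -[X in (_ * X)%R]FracField.pi_inv -[RHS]FracField.pi_mul.
rewrite /FracField.mulf /FracField.invf /=.
by rewrite !numden_Ratio ?oner_neq0 ?denom_ratioP // mulr1 mul1r.
Qed.

(* The derivation does not depend on the chosen representative. *)
Lemma mero_dx_frac (I : ointerval) (a b : anfun I) : b != 0%R ->
  mero_dx (an_frac a / an_frac b)%R =
    (an_frac (an_dx a * b - a * an_dx b)%R / an_frac b ^+ 2)%R.
Proof.
move=> b0; set q := (_ / _)%R; rewrite /mero_dx.
have E := mero_repr q.
have : \d_(repr q) != 0%R by exact: denom_ratioP.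
move: E; set n := \n_(repr q); set d := \d_(repr q) => E d0.
have F0 (c : anfun I) : c != 0%R -> an_frac c != 0%R by rewrite /an_frac tofrac_eq0.
have nb : (n * b = a * d)%R.
  apply/eqP; rewrite -tofrac_eq !tofracM -eqr_div; last 2 first.
  - exact: F0.
  - exact: F0.
  by rewrite -[X in X == _]/(an_frac n / an_frac d)%R -E.
have := congr1 (@an_dx I) nb; rewrite !an_dx_mul => Dnb.
apply/eqP; rewrite eqr_div ?expf_neq0 ?F0 // /an_frac -!tofracXn -!tofracM tofrac_eq.
apply/eqP; move: Dnb nb; move: (an_dx n) (an_dx d) (an_dx a) (an_dx b) => n' d' a' b' Dnb nb.
transitivity (d * b * (n' * b + n * b') - n * b * d * b' - d' * b * (n * b))%R.
  ring.
rewrite Dnb nb; ring.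
Qed.

Section Fields.
Variable F : fieldType.
Implicit Types (K L : {pred F}) (p q r : {poly F}).

(* K(g): the smallest subfield containing K and g. *)
Definition adjoin K (g : F) : {pred F} :=
  [pred z | `[< forall L, GRing.divring_closed L ->
                  {subset K <= L} -> g \in L -> z \in L >]].

Definition irreducible_over K p : Prop :=
  [/\ (1 < size p)%N, p \is a polyOver K &
    forall q r, q \is a polyOver K -> r \is a polyOver K -> p = (q * r)%R ->
      size q = 1%N \/ size r = 1%N].

End Fields.

Section Elementary.
Variable I : ointerval.
Implicit Types (K : {pred mero I}) (g : mero I).

Definition constants : {pred mero I} :=
  [pred z | `[< exists c : C, z = an_frac (an_const I c) >]].

Definition rational_functions : {pred mero I} :=
  adjoin constants (an_frac (an_x I)).

Definition exponential_over K g : Prop :=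
  exists2 s, s \in K & mero_dx g = (mero_dx s * g)%R.

Definition logarithmic_over K g : Prop :=
  exists s, [/\ s \in K, s != 0%R & mero_dx g = (mero_dx s / s)%R].

Definition algebraic_over K g : Prop :=
  exists2 p : {poly mero I}, irreducible_over K p & root p g.

Inductive elementary_field : {pred mero I} -> Prop :=
| Elementary_base : elementary_field rational_functions
| Elementary_step K g :
    elementary_field K ->
    exponential_over K g \/ logarithmic_over K g \/ algebraic_over K g ->
    elementary_field (adjoin K g).

Definition represents (h : R -> C) (z : mero I) : Prop :=
  exists a b : anfun I,
    [/\ b != 0%R, z = (an_frac a / an_frac b)%R &
        forall x, I x -> h x * b x = a x].

(* Smoothness makes the value of h at the zeros of the denominator b the
   limiting one, so that h is determined by its class. *)
Definition elementary_on (h : R -> C) : Prop :=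
  smooth_on I h /\
  exists K z, [/\ elementary_field K, z \in K & represents h z].

Definition liouville_condition (h : R -> C) : Prop :=
  exists (n : nat) (c : nat -> C) (hs : nat -> R -> C) (s : R -> C),
    [/\ forall i, (1 <= i <= n)%N ->
           elementary_on (hs i) /\ (forall x, I x -> hs i x <> 0),
        elementary_on s &
        forall x, I x ->
          h x = @sum_n_m C_AbelianMonoid
                  (fun i => c i * (dx (hs i) x / hs i x)) 1 n + dx s x].

End Elementary.

(* cascade f m u = d/dx f_m d/dx f_(m-1) ... d/dx f_1 d/dx u *)
Fixpoint cascade (f : nat -> R -> C) (m : nat) (u : R -> C) : R -> C :=
  match m with
  | 0%N => dx u
  | m'.+1 => dx (fun x => f m x * cascade f m' u x)
  end.

(* On smooth functions every intermediate derivative in the cascade exists. *)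
Definition solves_on (I : ointerval) (f : nat -> R -> C) (m : nat)
    (g u : R -> C) : Prop :=
  smooth_on I u /\ (forall x, I x -> cascade f m u x = g x).

(* Main.v *)
Require Import Defs.
From Stdlib Require Import Reals.
From Coquelicot Require Import Coquelicot.
From mathcomp Require Import all_boot.
From Stdlib Require Import Lra Lia.
From mathcomp Require Import all_algebra boolp.
Import GRing.Theory.

Set Implicit Arguments.
Unset Strict Implicit.
Unset Printing Implicit Defensive.

(** Fix t and write h for g_{2:k-1} / f_1.  If h is the sum of the c_i h_i'/h_i
    and s', then it has the primitive v = s + sum of the c_i log h_i, and v is
    elementary because each log h_i generates a logarithmic extension.  The
    integral of h from x0 differs from v by a constant, so it is elementary too
    ([liouville_integral]).  That it solves the equation is a telescoping
    computation: f_1 u' = g_{2:k-1}, and by hypothesis f_i times the derivative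
    of g_{i:k-1} is g_{i+1:k-1}, until the chain reaches R, then G, then g
    ([cascade_telescope]).

    Two points need care.  First, the functions h_1, ..., h_n and s belong to
    unrelated towers of elementary extensions, so sums make sense only in a
    common tower; composita of towers are elementary because each kind of simple
    extension stays of that kind over a larger field
    ([elementary_field_join]).

    Second, log h_i must be an element of the field of quotients of analytic
    functions, whereas h_i is only known to be a smooth function that represents
    such a quotient.  A continuous function h with h b = a, where a and b are
    analytic and b is not identically zero, is analytic: write b as (x - c)^m
    times a unit and cancel the powers of x - c ([real_analytic_quotient]).  This
    requires the reciprocal of a nonvanishing analytic function to be analytic
    ([real_analytic_inv]), as does the analyticity of the primitive of h_i'/h_i
    that serves as log h_i ([elementary_log_exists]). *)

(** * Reciprocals of analytic functions *)

Section PowerSeriesInverse.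
Local Open Scope R_scope.

(** The coefficients of the reciprocal of a power series satisfy a recurrence
    on all the previous ones.  To keep the recursion structural, stage n is a
    whole function that is correct at the indices 0, ..., n; its values beyond
    n are junk. *)
Fixpoint ps_inv_upto (a : nat -> R) (n : nat) : nat -> R :=
  match n with
  | O => fun _ => / a 0%N
  | S n' => fun m =>
      if (m <= n')%N then ps_inv_upto a n' m
      else - / a 0%N * sum_f_R0 (fun k => a (S k) * ps_inv_upto a n' (n' - k)%coq_nat) n'
  end.

Definition ps_inv (a : nat -> R) (n : nat) : R := ps_inv_upto a n n.

Lemma ps_inv_upto_le (a : nat -> R) (n m : nat) :
  (m <= n)%N -> ps_inv_upto a n m = ps_inv a m.
Proof.
elim: n => [|n IHn]; first by rewrite leqn0 => /eqP ->.
rewrite leq_eqVlt => /predU1P[-> //|]; rewrite ltnS => mn /=.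
by rewrite mn IHn.
Qed.

Lemma ps_inv_S (a : nat -> R) (n : nat) :
  ps_inv a (S n) =
  - / a 0%N * sum_f_R0 (fun k => a (S k) * ps_inv a (n - k)%coq_nat) n.
Proof.
rewrite {1}/ps_inv /= ltnn; congr (_ * _).
apply: PartSum.sum_eq => k _; congr (_ * _); apply: ps_inv_upto_le.
by apply/leP; lia.
Qed.

Lemma PS_mult_inv (a : nat -> R) : a 0%N <> 0 ->
  forall n, PS_mult a (ps_inv a) n = if n is O then 1 else 0.
Proof.
move=> a0 [|n]; rewrite /PS_mult.
  by rewrite /= /ps_inv /=; field.
rewrite decomp_sum; last by lia.
rewrite Nat.sub_0_r ps_inv_S /=.
by field.
Qed.

(** A geometric bound on the coefficients of a series is inherited by its
    reciprocal.  With A = |a 0|, the ratio q = t (1 + M / A) is the one for which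
    the recurrence closes: the sum of t^(k+1) q^(n-k) over k <= n is at most
    q^(n+1) t / (q - t), and t / (q - t) = A / M. *)
Lemma ps_inv_bound (a : nat -> R) (M t : R) :
  a 0%N <> 0 -> 0 < M -> 0 < t -> (forall n, Rabs (a n) <= M * t ^ n) ->
  forall n, Rabs (ps_inv a n) <= / Rabs (a 0%N) * (t * (1 + M / Rabs (a 0%N))) ^ n.
Proof.
move=> a0 M0 t0 Ha; have A0 := Rabs_pos_lt _ a0.
set A := Rabs (a 0%N) in A0 *; set q := t * _.
have MA : 0 < M / A by apply: Rdiv_lt_0_compat.
have q0 : 0 < q by rewrite /q; apply: Rmult_lt_0_compat; lra.
have Ai : 0 < / A by apply: Rinv_0_lt_compat.
have D n : sum_f_R0 (fun k => t ^ (S k) * q ^ (n - k)%coq_nat) n <=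
    q ^ S n / (M / A).
  have E : sum_f_R0 (fun k => t ^ (S k) * q ^ (n - k)%coq_nat) n * (q - t) =
      t * (q ^ S n - t ^ S n).
    elim: n => [|n IHn]; first by rewrite /=; ring.
    rewrite tech5 Nat.sub_diag.
    have -> : sum_f_R0 (fun k => t ^ (S k) * q ^ (S n - k)%coq_nat) n =
        q * sum_f_R0 (fun k => t ^ (S k) * q ^ (n - k)%coq_nat) n.
      rewrite scal_sum; apply: PartSum.sum_eq => k kn.
      by rewrite Nat.sub_succ_l // /=; ring.
    rewrite Rmult_plus_distr_r Rmult_assoc IHn /=; ring.
  have qt : q - t = t * (M / A) by rewrite /q; ring.
  have qt0 : 0 < q - t by rewrite qt; apply: Rmult_lt_0_compat.
  apply: (Rmult_le_reg_r (q - t)) => //; rewrite E qt.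
  have -> : q ^ S n / (M / A) * (t * (M / A)) = t * q ^ S n by field; lra.
  apply: Rmult_le_compat_l; first lra.
  have := pow_lt t (S n) t0; lra.
have strong : forall n m, (m <= n)%coq_nat -> Rabs (ps_inv a m) <= / A * q ^ m.
  elim=> [|n IHn] m mn.
    have -> : m = 0%N by lia.
    by rewrite /ps_inv /= Rabs_inv -/A; lra.
  case: (Nat.eq_dec m (S n)) => [->|ne]; last by apply: IHn; lia.
  rewrite ps_inv_S Rabs_mult Rabs_Ropp Rabs_inv -/A.
  apply: Rmult_le_compat_l; first lra.
  apply: Rle_trans (Rsum_abs _ _) _.
  apply: (Rle_trans _ (sum_f_R0
      (fun k => (t ^ (S k) * q ^ (n - k)%coq_nat) * (M / A)) n)).
    apply: sum_Rle => k kn; rewrite Rabs_mult.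
    have -> : t ^ S k * q ^ (n - k)%coq_nat * (M / A) =
        (M * t ^ S k) * (/ A * q ^ (n - k)%coq_nat) by rewrite /Rdiv; ring.
    apply: Rmult_le_compat; try exact: Rabs_pos; first exact: Ha.
    by apply: IHn; lia.
  rewrite -scal_sum.
  have := Rmult_le_compat_l (M / A) _ _ (Rlt_le _ _ MA) (D n).
  by have -> : M / A * (q ^ S n / (M / A)) = q ^ S n by field; lra.
by move=> n; apply: (strong n n).
Qed.

Lemma CV_radius_gt0_of_bound (a : nat -> R) (M q : R) :
  0 < q -> (forall n, Rabs (a n) <= M * q ^ n) -> Rbar_le (/ q) (CV_radius a).
Proof.
move=> q0 H; case: (CV_radius_bounded a) => + _; apply.
exists M => n; rewrite Rabs_mult -RPow_abs Rabs_inv (Rabs_pos_eq q); last lra.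
have qn := pow_lt q n q0.
rewrite pow_inv.
apply: (Rmult_le_reg_r (q ^ n)) => //.
rewrite Rmult_assoc Rinv_l; last lra.
rewrite Rmult_1_r; exact: H.
Qed.

(** The reciprocal series has a positive radius of convergence by
    [ps_inv_bound], and inside both discs the Cauchy product of the two series
    is 1. *)
Lemma real_analytic_inv (f : R -> R) (c : R) :
  real_analytic_at f c -> f c <> 0 -> real_analytic_at (fun x => / f x) c.
Proof.
case/real_analytic_spec=> a [r [Hr Ha]] fc.
have rp := cond_pos r.
have a0 : a 0%N <> 0.
  move: fc; rewrite Ha; last by rewrite Rminus_diag Rabs_R0.
  by rewrite Rminus_diag PSeries_0.
(* Cauchy's estimate on the circle of radius r / 2, strictly inside the disc. *)
have [M HM] : exists M, forall n, Rabs (a n * (r / 2) ^ n) <= M.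
  have : ex_series (fun n => Rabs (a n * (r / 2) ^ n)).
    apply: CV_disk_inside; apply: Rbar_lt_le_trans Hr.
    by rewrite Rabs_pos_eq /=; lra.
  move/ex_series_lim_0 => lim0.
  have [M HM] := filterlim_bounded (K := R_AbsRing) (V := R_NormedModule) _ (ex_intro _ 0 lim0); exists M => n.
  by have := HM n; rewrite /norm /= /abs /= Rabs_Rabsolu.
set t := / (r / 2); have t0 : 0 < t by apply: Rinv_0_lt_compat; lra.
set M' := Rabs M + 1; have M'0 : 0 < M' by have := Rabs_pos M; rewrite /M'; lra.
have Hb n : Rabs (a n) <= M' * t ^ n.
  have := HM n; rewrite Rabs_mult -RPow_abs (Rabs_pos_eq (r / 2)); last lra.
  have pn : 0 < (r / 2) ^ n by apply: pow_lt; lra.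
  move=> H; apply: (Rmult_le_reg_r ((r / 2) ^ n)) => //.
  rewrite /t pow_inv Rmult_assoc Rinv_l; last lra.
  have := Rle_abs M; rewrite /M'; lra.
have := ps_inv_bound a0 M'0 t0 Hb; set q := t * _ => Hq.
have q0 : 0 < q.
  rewrite /q; apply: Rmult_lt_0_compat => //.
  have := Rdiv_lt_0_compat _ _ M'0 (Rabs_pos_lt _ a0); lra.
have HR := CV_radius_gt0_of_bound q0 Hq.
have qi : 0 < / q by apply: Rinv_0_lt_compat.
have mp : 0 < Rmin r (/ q) by apply: Rmin_pos.
apply: (@real_analytic_intro _ _ (ps_inv a) (mkposreal _ mp)).
  by apply: (Rbar_le_trans _ (/ q) _ _ HR); exact: Rmin_r.
move=> x /= Hx.
have xr : Rabs (x - c) < r by apply: (Rlt_le_trans _ _ _ Hx); exact: Rmin_l.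
have xq : Rabs (x - c) < / q by apply: (Rlt_le_trans _ _ _ Hx); exact: Rmin_r.
rewrite Ha //.
have P : PSeries a (x - c) * PSeries (ps_inv a) (x - c) = 1.
  rewrite -PSeries_mult; last first.
  - by apply: Rbar_lt_le_trans HR.
  - by apply: Rbar_lt_le_trans Hr.
  rewrite (PSeries_ext _ _ _ (PS_mult_inv a0)).
  rewrite (PSeries_decr_n_aux _ 0) /=; last by move=> k; lia.
  rewrite PSeries_decr_1.
    rewrite (PSeries_ext _ (fun _ => 0)) ?PSeries_const_0; first by rewrite /PS_decr_n /=; ring.
    by move=> n.
  apply: (@ex_pseries_ext _ _ (PS_mult a (ps_inv a))).
    by move=> n; rewrite PS_mult_inv.
  by apply: ex_pseries_mult; [apply: Rbar_lt_le_trans Hr | apply: Rbar_lt_le_trans HR].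
have ne : PSeries a (x - c) <> 0 by move=> E; move: P; rewrite E; lra.
apply: (Rmult_eq_reg_l (PSeries a (x - c))) => //.
by rewrite P Rinv_r.
Qed.

End PowerSeriesInverse.

(** * Removable singularities and primitives: the real case *)

Section RealQuotient.
Local Open Scope R_scope.

Lemma continuous_zero (u : R -> R) (c : R) :
  continuous u c -> locally c (fun x : R => x <> c -> u x = 0) -> u c = 0.
Proof.
move=> Hu H0; case: (Req_dec (u c) 0) => // uc.
have Hne : locally c (fun x : R => u x <> 0).
  by apply: (Hu (fun z : R => z <> 0)); exact: open_neq.
case: (filter_and _ _ H0 Hne) => e He.
have e0 := cond_pos e.
have [|H1 H2] := He (c + e / 2).
  change (Rabs (c + e / 2 - c) < e).
  by replace (c + e / 2 - c) with (e / 2) by ring; rewrite Rabs_pos_eq; lra.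
by case: H2; apply: H1; lra.
Qed.

Lemma real_analytic_continuous (f : R -> R) (c : R) :
  real_analytic_at f c -> continuous f c.
Proof. by move=> /real_analytic_ex_derive; exact: ex_derive_continuous. Qed.

Lemma real_analytic_factor (f : R -> R) (c : R) :
  real_analytic_at f c -> f c = 0 ->
  exists2 g, real_analytic_at g c & locally c (fun x : R => f x = (x - c) * g x).
Proof.
case/real_analytic_spec=> a [r [Hr Ha]] fc; have rp := cond_pos r.
exists (fun x => PSeries (PS_decr_1 a) (x - c)).
  by apply: (@real_analytic_intro _ _ (PS_decr_1 a) r) => //; rewrite CV_radius_decr_1.
exists r => x Hx; have Hx' : Rabs (x - c) < r by exact: Hx.
rewrite Ha // PSeries_decr_1.
  have -> : a 0%N = 0.
    by move: fc; rewrite Ha Rminus_diag ?Rabs_R0 // PSeries_0.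
  by rewrite Rplus_0_l.
by apply: CV_radius_inside; apply: Rbar_lt_le_trans Hr.
Qed.

(** The exponent m is the index of the first nonzero Taylor coefficient. *)
Lemma real_analytic_order (f : R -> R) (c : R) :
  real_analytic_at f c ->
  locally c (fun x : R => f x = 0) \/
  exists m g, [/\ real_analytic_at g c, g c <> 0 &
    locally c (fun x : R => f x = (x - c) ^ m * g x)].
Proof.
case/real_analytic_spec=> a [r [Hr Ha]]; have rp := cond_pos r.
case: (pselect (exists n, a n <> 0)) => [Hex|Hno]; last first.
  left; exists r => x Hx; rewrite Ha //.
  rewrite (PSeries_ext _ (fun _ => 0)) ?PSeries_const_0 // => n.
  by case: (Req_dec (a n) 0) => // Hn; case: Hno; exists n.
right.
have Hex' : exists n, `[< a n <> 0 >] by case: Hex => n Hn; exists n; apply/asboolP.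
case: (ex_minnP Hex') => m /asboolP Hm Hmin.
exists m, (fun x => PSeries (PS_decr_n a m) (x - c)); split.
- have rp2 : 0 < r / 2 by lra.
  apply: (@real_analytic_intro _ _ (PS_decr_n a m) (mkposreal _ rp2)) => //.
  apply: (Rbar_le_trans _ (Rabs (r / 2))).
    by rewrite Rabs_pos_eq /=; lra.
  apply: CV_radius_ge; apply: ex_pseries_decr_n.
    by right; exists (/ (r / 2)); apply: Rinv_l; lra.
  by apply: CV_radius_inside; apply: Rbar_lt_le_trans Hr; rewrite Rabs_pos_eq /=; lra.
- by rewrite Rminus_diag PSeries_0 /PS_decr_n Nat.add_0_r.
- exists r => x Hx; rewrite Ha //; apply: PSeries_decr_n_aux => k /ltP km.
  case: (Req_dec (a k) 0) => // /asboolP ak.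
  by have := Hmin _ ak; rewrite leqNgt km.
Qed.

(** Continuity of [h] rules out a pole: it makes [A] vanish at [c] when m > 0,
    so one factor (x - c) at a time can be cancelled.  Cancelling is legitimate
    only off [c]; the resulting identity extends to [c] by continuity. *)
Lemma real_analytic_div_pow (m : nat) (c : R) (h A : R -> R) :
  continuous h c -> real_analytic_at A c ->
  locally c (fun x : R => h x * (x - c) ^ m = A x) -> real_analytic_at h c.
Proof.
move=> hc; elim: m A => [|m IHm] A HA hA.
  apply: real_analytic_ext_loc HA.
  by apply: filter_imp hA => x /= <-; ring.
have Ac : A c = 0 by rewrite -(locally_singleton _ _ hA) Rminus_diag /=; ring.
have [A' HA' AA'] := real_analytic_factor HA Ac.
apply: (IHm A') => //.
have Hp : locally c (fun x : R => x <> c -> h x * (x - c) ^ m - A' x = 0).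
  apply: filter_imp (filter_and _ _ hA AA') => x [E1 E2] xc.
  apply: (Rmult_eq_reg_l (x - c)); last lra.
  by rewrite Rmult_minus_distr_l -E2 -E1 /=; ring.
have Hc : h c * (c - c) ^ m - A' c = 0.
  apply: (@continuous_zero (fun x => h x * (x - c) ^ m - A' x)) Hp.
  apply: (@continuous_minus _ R_AbsRing R_NormedModule); last exact: real_analytic_continuous.
  apply: (@continuous_mult _ R_AbsRing) => //.
  by apply: ex_derive_continuous; auto_derive.
apply: filter_imp Hp => x Hx.
by case: (Req_dec x c) => [->|/Hx]; lra.
Qed.

(** Removable singularities: [B] is (x - c)^m times a unit, so the statement
    reduces to division by (x - c)^m. *)
Lemma real_analytic_quotient (c : R) (h A B : R -> R) :
  continuous h c -> real_analytic_at A c -> real_analytic_at B c ->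
  ~ locally c (fun x : R => B x = 0) ->
  locally c (fun x : R => h x * B x = A x) -> real_analytic_at h c.
Proof.
move=> hc HA HB; case: (real_analytic_order HB) => [//|[m [g [Hg gc Bg]]]] _ hB.
apply: (@real_analytic_div_pow m c h (fun x => A x * / g x)) => //.
  by apply: real_analytic_mult => //; exact: real_analytic_inv.
have Hne : locally c (fun x : R => g x <> 0).
  have Hgc := real_analytic_continuous Hg.
  by apply: (Hgc (fun z : R => z <> 0)); exact: open_neq.
apply: filter_imp (filter_and _ _ Hne (filter_and _ _ hB Bg)) => x [gx [<- ->]].
by field.
Qed.

(** Near [c], [F] differs by a constant from the series obtained by termwise
    integration. *)
Lemma real_analytic_primitive (F f : R -> R) (c : R) :
  locally c (fun x : R => is_derive F x (f x)) -> real_analytic_at f c ->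
  real_analytic_at F c.
Proof.
move=> [d Hd] /real_analytic_spec [a [r [Hr Ha]]].
have rp := cond_pos r; have dp := cond_pos d.
have mp : 0 < Rmin r d by apply: Rmin_pos.
pose P x := PSeries (PS_Int a) (x - c).
have HP : real_analytic_at P c.
  by apply: (@real_analytic_intro _ _ (PS_Int a) r) => //; rewrite CV_radius_Int.
apply: (@real_analytic_ext_loc (fun x => P x + (F c - P c))); last first.
  by apply: real_analytic_plus => //; exact: real_analytic_const.
exists (mkposreal _ mp) => x Hx; have Hx' : Rabs (x - c) < Rmin r d by exact: Hx.
have D t : Rabs (t - c) <= Rabs (x - c) -> is_derive (fun y => F y - P y) t zero.
  move=> Ht; have tm : Rabs (t - c) < Rmin r d by lra.
  have tr : Rabs (t - c) < r by have := Rmin_l r d; lra.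
  have td : Rabs (t - c) < d by have := Rmin_r r d; lra.
  have <- : minus (f t) (f t) = zero :> R by exact: minus_eq_zero.
  apply: (is_derive_minus F P); first exact: Hd.
  have ta : Rbar_lt (Rabs (t - c)) (CV_radius a) by apply: Rbar_lt_le_trans Hr.
  rewrite Ha //.
  have -> : PSeries a (t - c) = 1 * PSeries (PS_derive (PS_Int a)) (t - c).
    rewrite Rmult_1_l; apply: PSeries_ext => n; rewrite /PS_derive /PS_Int.
    by field; exact: not_0_INR.
  apply: (is_derive_comp (PSeries (PS_Int a)) (fun y => y - c) t).
    by apply: is_derive_PSeries; rewrite CV_radius_Int.
  by auto_derive => //; ring.
have E : F x - P x = F c - P c.
  case: (Rtotal_order c x) => [lt|[-> //|lt]].
  - symmetry; apply: (@eq_is_derive _ (fun y => F y - P y)) lt => t Ht; apply: D.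
    by rewrite !Rabs_pos_eq; lra.
  - apply: (@eq_is_derive _ (fun y => F y - P y)) lt => t Ht; apply: D.
    by rewrite !Rabs_left1; lra.
by rewrite -E; ring.
Qed.

End RealQuotient.

(** * Complex-valued functions on an interval *)

Section ComplexAnalytic.
Local Open Scope C_scope.
Implicit Types (f g h a b F : R -> C) (c : R).

Lemma is_dx_ext_loc f g (x : R) (l : C) :
  locally x (fun y : R => f y = g y) -> is_dx f x l -> is_dx g x l.
Proof. exact: is_derive_ext_loc. Qed.

Lemma analytic_continuous f c : analytic_at f c ->
  @continuous R_UniformSpace C_R_NormedModule f c.
Proof. by move=> /analytic_ex_derive; exact: ex_derive_continuous. Qed.

Lemma continuous_re_im f c : @continuous R_UniformSpace C_R_NormedModule f c ->
  continuous (fun x => Re (f x)) c /\ continuous (fun x => Im (f x)) c.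
Proof.
move=> fc; split.
- apply: (continuous_comp f fst _ fc); case: (f c) => u v; exact: continuous_fst.
- apply: (continuous_comp f snd _ fc); case: (f c) => u v; exact: continuous_snd.
Qed.

Lemma real_analytic_normsq b c : analytic_at b c ->
  real_analytic_at (fun x => Re (b x) * Re (b x) + Im (b x) * Im (b x))%coqR c.
Proof.
move=> /analytic_components [b1 b2].
by apply: real_analytic_plus; exact: real_analytic_mult.
Qed.

Lemma normsq_eq0 (z : C) : (Re z * Re z + Im z * Im z = 0)%coqR -> z = 0.
Proof. by case: z => u v /= H; congr pair; nra. Qed.

(** Multiplying by the conjugate of [b] replaces the denominator by the real
    function |b|^2, so the real case applies to Re h and Im h separately. *)
Lemma analytic_quotient c h a b :
  @continuous R_UniformSpace C_R_NormedModule h c ->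
  analytic_at a c -> analytic_at b c ->
  ~ locally c (fun x : R => b x = 0) ->
  locally c (fun x : R => h x * b x = a x) -> analytic_at h c.
Proof.
move=> /continuous_re_im [h1 h2] Ha Hb b0 hb.
have HB := real_analytic_normsq Hb.
have B0 : ~ locally c (fun x : R => (Re (b x) * Re (b x) + Im (b x) * Im (b x) = 0)%coqR).
  by move=> H; apply: b0; apply: filter_imp H => x; exact: normsq_eq0.
move: Ha Hb => /analytic_components [a1 a2] /analytic_components [b1 b2].
apply/analytic_components; split.
- apply: (@real_analytic_quotient c _
    (fun x => Re (a x) * Re (b x) + Im (a x) * Im (b x))%coqR) HB B0 _ => //.
    by apply: real_analytic_plus; exact: real_analytic_mult.
  apply: filter_imp hb => x <-; rewrite /Re /Im /=; ring.
- apply: (@real_analytic_quotient c _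
    (fun x => Im (a x) * Re (b x) + - (Re (a x) * Im (b x)))%coqR) HB B0 _ => //.
    apply: real_analytic_plus; first exact: real_analytic_mult.
    by apply: real_analytic_opp; exact: real_analytic_mult.
  apply: filter_imp hb => x <-; rewrite /Re /Im /=; ring.
Qed.

Lemma analytic_inv f c : analytic_at f c -> f c <> 0 -> analytic_at (fun x => / f x) c.
Proof.
move=> Hf fc.
have HB : real_analytic_at
    (fun x => / (Re (f x) * Re (f x) + Im (f x) * Im (f x)))%coqR c.
  apply: (real_analytic_inv (real_analytic_normsq Hf)).
  by move/normsq_eq0; exact: fc.
move: Hf => /analytic_components [f1 f2].
apply/analytic_components; split.
- apply: (real_analytic_ext_loc _ (real_analytic_mult f1 HB)).
  by apply: filter_forall => x; rewrite /Cinv /Rdiv /= !Rmult_1_r.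
- apply: (real_analytic_ext_loc _ (real_analytic_mult (real_analytic_opp f2) HB)).
  by apply: filter_forall => x; rewrite /Cinv /Rdiv /= !Rmult_1_r.
Qed.

Lemma analytic_primitive F f c :
  locally c (fun x : R => is_dx F x (f x)) -> analytic_at f c -> analytic_at F c.
Proof.
move=> H /analytic_components [f1 f2]; apply/analytic_components; split.
- by apply: real_analytic_primitive f1; apply: filter_imp H => x /is_dx_components [].
- by apply: real_analytic_primitive f2; apply: filter_imp H => x /is_dx_components [].
Qed.

Variable I : ointerval.

Lemma is_dx_RInt h (x0 x : R) :
  (forall y, I y -> @continuous R_UniformSpace C_R_NormedModule h y) ->
  I x0 -> I x ->
  is_dx (fun y => @RInt C_R_CompleteNormedModule h x0 y) x (h x).
Proof.
move=> hc I0 Ix; apply: (@is_derive_RInt C_R_NormedModule h _ x0); last exact: hc.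
apply: filter_imp (itv_locally Ix) => y Iy.
apply: (@RInt_correct C_R_CompleteNormedModule).
apply: (@ex_RInt_continuous C_R_CompleteNormedModule) => z Hz; apply: hc.
move: Hz; rewrite /Rmin /Rmax; case: Rle_dec => _ Hz.
- exact: (itv_convex I0 Iy Hz).
- exact: (itv_convex Iy I0 Hz).
Qed.

Lemma analytic_has_primitive h : (forall x, I x -> analytic_at h x) ->
  exists l : anfun I, forall x, I x -> is_dx l x (h x).
Proof.
move=> Hh; have [x0 I0] := itv_nonempty I.
have D x : I x -> is_dx (fun y => @RInt C_R_CompleteNormedModule h x0 y) x (h x).
  by apply: is_dx_RInt => // y /Hh; exact: analytic_continuous.
have HF x : I x -> analytic_at (fun y => @RInt C_R_CompleteNormedModule h x0 y) x.
  move=> Ix; apply: (analytic_primitive _ (Hh _ Ix)).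
  by apply: filter_imp (itv_locally Ix) => y; exact: D.
exists (mk_anfun HF) => x Ix; apply: is_dx_ext_loc (D _ Ix).
by apply: filter_imp (itv_locally Ix) => y Iy; rewrite /= restr_in.
Qed.

Lemma eq_dx_const f g : (forall x, I x -> exists l, is_dx f x l /\ is_dx g x l) ->
  exists k : C, forall x, I x -> f x = g x + k.
Proof.
move=> H; have [x0 I0] := itv_nonempty I.
exists (f x0 - g x0) => x Ix.
have D t : I t -> @is_derive R_AbsRing C_R_NormedModule (fun y => minus (f y) (g y)) t zero.
  case/H=> l [fl gl]; rewrite -(minus_eq_zero l); exact: is_derive_minus.
have E : minus (f x0) (g x0) = minus (f x) (g x) :> C_R_NormedModule.
  case: (Rtotal_order x0 x) => [lt|[-> //|lt]].
  - apply: (@eq_is_derive _ (fun y => minus (f y) (g y))) lt => t Ht; apply: D.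
    exact: (itv_convex I0 Ix Ht).
  - symmetry; apply: (@eq_is_derive _ (fun y => minus (f y) (g y))) lt => t Ht.
    by apply: D; exact: (itv_convex Ix I0 Ht).
have -> : f x0 - g x0 = f x - g x by exact: E.
ring.
Qed.

Lemma analytic_smooth f : (forall x, I x -> analytic_at f x) -> smooth_on I f.
Proof.
move=> Hf n x Ix; apply: analytic_ex_derive.
by elim: n => [|n IHn] /=; [exact: Hf | exact: analytic_dx].
Qed.

End ComplexAnalytic.

(** * Adjunction and composita of elementary fields *)

Section Adjunction.
Local Open Scope ring_scope.
Variable F : fieldType.
Implicit Types (K L : {pred F}) (g z : F) (p q r : {poly F}).

Lemma sub_adjoin K g : {subset K <= adjoin K g}.
Proof. by move=> z Kz; apply/asboolP => L _ KL _; exact: KL. Qed.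

Lemma mem_adjoin K g : g \in adjoin K g.
Proof. by apply/asboolP => L _ _. Qed.

Lemma adjoin_min K L g :
  GRing.divring_closed L -> {subset K <= L} -> g \in L ->
  {subset adjoin K g <= L}.
Proof. by move=> cL KL Lg z /asboolP; apply. Qed.

Lemma adjoin_divring_closed K g : GRing.divring_closed (adjoin K g).
Proof.
split=> [|u v /asboolP Hu /asboolP Hv|u v /asboolP Hu /asboolP Hv];
  apply/asboolP => L cL KL Lg; have [L1 LB LD] := cL => //.
- by apply: LB; [apply: Hu | apply: Hv].
- by apply: LD; [apply: Hu | apply: Hv].
Qed.

(** An annihilating polynomial of least size is irreducible: in a factorisation
    one of the factors vanishes at [g], hence has full size. *)
Lemma irreducible_over_annihilator K p g :
  p \is a polyOver K -> p != 0 -> root p g ->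
  exists2 q, irreducible_over K q & root q g.
Proof.
move=> Kp p0 pg.
pose P n := `[< exists q, [/\ q \is a polyOver K, q != 0, root q g & size q = n] >].
have exP : exists n, P n by exists (size p); apply/asboolP; exists p.
case: (ex_minnP exP) => _ /asboolP[q [Kq q0 qg <-]] qmin.
have min r : r \is a polyOver K -> r != 0 -> root r g -> (size q <= size r)%N.
  by move=> Kr r0 rg; apply: qmin; apply/asboolP; exists r.
exists q => //; split=> // [|r s Kr Ks qrs].
  exact: root_size_gt1 qg.
move: q0; rewrite qrs mulf_eq0 negb_or => /andP[r0 s0].
have size_rs := size_mul r0 s0; rewrite -qrs in size_rs.
have size1 m n : (0 < n)%N -> ((m + n).-1 <= m)%N -> n = 1%N.
  by case: n => [|[|n]] // _; rewrite !addnS /= ltnNge leq_addr.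
move: qg; rewrite qrs rootM => /orP[rg|sg]; [right|left].
- by apply: (size1 (size r)); rewrite ?size_poly_gt0 // -size_rs min.
- by apply: (size1 (size s)); rewrite ?size_poly_gt0 // addnC -size_rs min.
Qed.
End Adjunction.

Section ElementaryFields.
Local Open Scope ring_scope.
Variable I : ointerval.
Implicit Types (K L M : {pred mero I}) (g z : mero I).

Definition elementary_over K g : Prop :=
  exponential_over K g \/ logarithmic_over K g \/ algebraic_over K g.

(** This is what makes composita of towers elementary.  Only the algebraic case
    has content: a polynomial irreducible over [K] may split over [L], but [g]
    is still a root of one irreducible over [L]. *)
Lemma elementary_overS K L g :
  {subset K <= L} -> elementary_over K g -> elementary_over L g.
Proof.
move=> KL [[s /KL Ls gs]|[[s [/KL Ls s0 gs]]|[p [p1 /polyOverS Kp _] pg]]].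
- by left; exists s.
- by right; left; exists s.
- right; right; apply: (@irreducible_over_annihilator _ L p g) => //.
    exact: Kp.
  by rewrite -size_poly_gt0 ltnW.
Qed.

Lemma elementary_field_divring_closed K :
  elementary_field K -> GRing.divring_closed K.
Proof. by case=> [|L g _ _]; exact: adjoin_divring_closed. Qed.

Lemma rational_functions_sub K :
  elementary_field K -> {subset @rational_functions I <= K}.
Proof. by elim=> // L g _ IH _ z /IH; exact: sub_adjoin. Qed.

(** Adjoin to [K], one after the other, the generators of the tower of [L]. *)
Lemma elementary_field_join K L :
  elementary_field K -> elementary_field L ->
  exists M, [/\ elementary_field M, {subset K <= M} & {subset L <= M}].
Proof.
move=> eK; elim=> [|L' g _ [M [eM KM LM]] Lg].
  by exists K; split=> //; exact: rational_functions_sub.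
exists (adjoin M g); split.
- by apply: Elementary_step => //; exact: elementary_overS Lg.
- by move=> z /KM; exact: sub_adjoin.
- apply: adjoin_min; first exact: adjoin_divring_closed.
    by move=> z /LM; exact: sub_adjoin.
  exact: mem_adjoin.
Qed.

Lemma mero_dx_an_frac (f : anfun I) : mero_dx (an_frac f) = an_frac (an_dx f).
Proof.
have -> : an_frac f = an_frac f / an_frac 1 by rewrite /an_frac tofrac1 divr1.
rewrite mero_dx_frac ?oner_neq0 //.
have -> : an_dx (1 : anfun I) = 0.
  apply: anfun_eq => x Ix; rewrite /= !restr_in //.
  rewrite (@dx_ext_loc _ (fun _ => RtoC 1)); last first.
    by apply: filter_imp (itv_locally Ix) => y Iy; rewrite restr_in.
  by rewrite /dx !Derive_const.
by rewrite mulr1 mulr0 subr0 /an_frac tofrac1 expr1n divr1.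
Qed.

Definition elementary_anfun (f : anfun I) : Prop :=
  exists2 K, elementary_field K & an_frac f \in K.

Lemma elementary_anfun_const (c : C) : elementary_anfun (an_const I c).
Proof.
exists (@rational_functions I); first exact: Elementary_base.
by apply: sub_adjoin; apply/asboolP; exists c.
Qed.

Lemma elementary_anfun_add (f g : anfun I) :
  elementary_anfun f -> elementary_anfun g -> elementary_anfun (f + g).
Proof.
move=> [K eK Kf] [L eL Lg].
have [M [eM KM LM]] := elementary_field_join eK eL.
have [Mf Mg] := (KM _ Kf, LM _ Lg); exists M => //.
have /GRing.divring_closedBM/GRing.subring_closedB/GRing.zmod_closedD[_ MD] :=
  elementary_field_divring_closed eM.
by rewrite /an_frac tofracD; apply: MD.
Qed.

Lemma elementary_anfun_mul (f g : anfun I) :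
  elementary_anfun f -> elementary_anfun g -> elementary_anfun (f * g).
Proof.
move=> [K eK Kf] [L eL Lg].
have [M [eM KM LM]] := elementary_field_join eK eL.
have [Mf Mg] := (KM _ Kf, LM _ Lg); exists M => //.
have /GRing.divring_closedBM/GRing.subring_closedM/GRing.smulr_closedM[_ MM] :=
  elementary_field_divring_closed eM.
by rewrite /an_frac tofracM; apply: MM.
Qed.

(** Any [l] with l' = f' / f is a logarithm of [f]; the equation is stated
    without a denominator because [anfun I] is only a ring. *)
Lemma elementary_anfun_log (f l : anfun I) :
  elementary_anfun f -> f != 0 -> an_dx l * f = an_dx f -> elementary_anfun l.
Proof.
move=> [K eK Kf] f0 lf; exists (adjoin K (an_frac l)); last exact: mem_adjoin.
apply: Elementary_step => //; right; left; exists (an_frac f).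
have F0 : an_frac f != 0 by rewrite /an_frac tofrac_eq0.
by split=> //; rewrite !mero_dx_an_frac -lf /an_frac tofracM mulfK.
Qed.

End ElementaryFields.

(** * Integrals under Liouville's condition *)

Section Liouville.
Variable I : ointerval.
Local Open Scope C_scope.

Lemma anfun_locally_neq0 (b : anfun I) c :
  b <> 0%R -> I c -> ~ locally c (fun x : R => b x = 0).
Proof.
move=> b0 Ic H; apply: b0; apply: anfun_eq => x Ix; rewrite /= restr_in //.
apply: injective_projections.
- apply: (@real_analytic_identity I (fun x => Re (b x)) c) => //.
  + by move=> y /(anfun_analytic b) /analytic_components [].
  + by apply: filter_imp H => y ->.
- apply: (@real_analytic_identity I (fun x => Im (b x)) c) => //.
  + by move=> y /(anfun_analytic b) /analytic_components [].
  + by apply: filter_imp H => y ->.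
Qed.


(** An elementary function is a smooth quotient of analytic functions, so its
    singularities are removable and it is itself analytic.  This is what turns
    the data of Liouville's condition into elements of the ring [anfun I]. *)
Lemma elementary_on_anfun (h : R -> C) :
  elementary_on I h ->
  exists2 f : anfun I, elementary_anfun f & forall x, I x -> f x = h x.
Proof.
case=> hs [K [z [eK Kz [a [b [/eqP b0 zab hb]]]]]].
have Hh x : I x -> analytic_at h x.
  move=> Ix; apply: (@analytic_quotient x h a b).
  - by apply: ex_derive_continuous; exact: (hs 0%N x Ix).
  - exact: anfun_analytic.
  - exact: anfun_analytic.
  - exact: anfun_locally_neq0.
  - by apply: filter_imp (itv_locally Ix) => y; exact: hb.
exists (mk_anfun Hh) => [|x Ix]; last by rewrite /= restr_in.
exists K => //; suff -> : an_frac (mk_anfun Hh) = z by [].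
have E : (mk_anfun Hh * b)%R = a.
  by apply: anfun_eq => x Ix; rewrite /= !restr_in //; exact: hb.
rewrite zab -E /an_frac tofracM mulfK // tofrac_eq0; exact/eqP.
Qed.

Lemma anfun_elementary_on (f : anfun I) (h : R -> C) :
  elementary_anfun f -> (forall x, I x -> f x = h x) -> elementary_on I h.
Proof.
move=> [K eK Kf] fh; split.
  apply: analytic_smooth => x Ix; apply: (analytic_ext_loc _ (anfun_analytic f Ix)).
  by apply: filter_imp (itv_locally Ix) => y; exact: fh.
exists K, (an_frac f); split=> //; exists f, 1%R; split.
- exact: oner_neq0.
- by rewrite /an_frac tofrac1 divr1.
- by move=> x Ix; rewrite -fh //= restr_in //; ring.
Qed.

Lemma an_dxE (f : anfun I) (x : R) : I x -> is_dx f x (an_dx f x).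
Proof.
move=> Ix; rewrite /= restr_in //; apply: dx_correct; apply: analytic_ex_derive.
exact: anfun_analytic.
Qed.

Lemma anfun_is_dx (f : anfun I) (h : R -> C) (x : R) :
  (forall y, I y -> f y = h y) -> I x -> is_dx h x (an_dx f x).
Proof.
move=> fh Ix; apply: is_dx_ext_loc (an_dxE f Ix).
by apply: filter_imp (itv_locally Ix) => y; exact: fh.
Qed.

(** A nowhere vanishing complex function on an interval has a global logarithm,
    obtained without any choice of branch by integrating h' / h. *)
Lemma elementary_log_exists (h : R -> C) :
  elementary_on I h -> (forall x, I x -> h x <> 0) ->
  exists2 l : anfun I, elementary_anfun l &
    forall x, I x -> is_dx l x (dx h x / h x).
Proof.
move=> /elementary_on_anfun [f ef fh] h0.
have fx0 x : I x -> f x <> 0 by move=> Ix; rewrite fh //; exact: h0.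
have [|l Hl] := @analytic_has_primitive I (fun x => dx f x * / f x).
  move=> x Ix; have fa := anfun_analytic f Ix.
  by apply: analytic_mult; [exact: analytic_dx | apply: analytic_inv => //; exact: fx0].
exists l.
  apply: elementary_anfun_log ef _ _.
    apply/eqP => f0; have [x Ix] := itv_nonempty I.
    by apply: (fx0 _ Ix); rewrite f0 /= restr_in.
  apply: anfun_eq => x Ix; rewrite /= !restr_in // (dx_unique (Hl _ Ix)).
  by field; exact: fx0.
move=> x Ix; have := Hl _ Ix; rewrite /Cdiv -fh //.
have -> // : dx f x = dx h x.
apply: dx_ext_loc; apply: filter_imp (itv_locally Ix) => y; exact: fh.
Qed.

(** The easy direction of Liouville's theorem: the sum of the c_i log h_i and s
    is an elementary primitive. *)
Lemma liouville_primitive (h : R -> C) :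
  liouville_condition I h ->
  exists2 v : anfun I, elementary_anfun v & forall x, I x -> is_dx v x (h x).
Proof.
case=> n [c [hs [s [Hhs /elementary_on_anfun [S eS Ss] hE]]]].
suff [v ev Hv] : exists2 v : anfun I, elementary_anfun v &
    forall x, I x -> is_dx v x (@sum_n_m C_AbelianMonoid
      (fun i => c i * (dx (hs i) x / hs i x)) 1 n + dx s x).
  by exists v => // x Ix; rewrite hE //; exact: Hv.
elim: n Hhs {hE} => [|n IHn] Hhs.
  exists S => // x Ix; rewrite sum_n_m_zero //.
  have <- : an_dx S x = dx s x by rewrite (dx_unique (anfun_is_dx Ss Ix)).
  have -> : zero + an_dx S x = an_dx S x by exact: Cplus_0_l.
  exact: an_dxE.
have [i in1|v ev Hv] := IHn.
  by apply: Hhs; case/andP: in1 => -> /leqW ->.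
have [el nz] := Hhs n.+1 (ltac:(by rewrite ltnS leqnn)).
have [l el' Hl] := elementary_log_exists el nz.
exists (v + an_const I (c n.+1) * l)%R.
  apply: elementary_anfun_add => //; apply: elementary_anfun_mul => //.
  exact: elementary_anfun_const.
move=> x Ix; rewrite sum_n_Sm; last by lia.
apply: (@is_dx_ext_loc (fun y => v y + c n.+1 * l y)).
  apply: filter_imp (itv_locally Ix) => y Iy.
  by rewrite /= !restr_in //= !restr_in.
have := is_dx_mult (@is_derive_const R_AbsRing C_R_NormedModule (c n.+1) x) (Hl _ Ix).
move/(@is_derive_plus R_AbsRing C_R_NormedModule _ _ _ _ _ (Hv _ Ix)).
set d1 := plus _ _; set d2 := (_ + _) => D; have <- // : d1 = d2.
have E (a b e q r : C) : (a + b) + (0 * e + q * r) = (a + q * r) + b by ring.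
exact: E.
Qed.

(** The integral from [x0] and the elementary primitive differ by a constant. *)
Lemma liouville_integral (h : R -> C) (x0 : R) :
  liouville_condition I h -> I x0 ->
  let u x := @RInt C_R_CompleteNormedModule h x0 x in
  elementary_on I u /\ forall x, I x -> is_dx u x (h x).
Proof.
move=> /liouville_primitive [v ev Hv] I0 u.
have Hu x : I x -> is_dx u x (h x).
  apply: is_dx_RInt => // y Iy.
  apply: (@continuous_ext_loc R_UniformSpace C_R_NormedModule h (dx v) y).
    by apply: filter_imp (itv_locally Iy) => t It; rewrite (dx_unique (Hv _ It)).
  by apply: analytic_continuous; apply: analytic_dx; exact: anfun_analytic.
split=> //.
have [|k uk] := @eq_dx_const I u v; first by move=> x Ix; exists (h x); split; auto.
apply: (@anfun_elementary_on (v + an_const I k)%R).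
  by apply: elementary_anfun_add => //; exact: elementary_anfun_const.
by move=> x Ix; rewrite uk //= !restr_in.
Qed.

Lemma cascade_telescope (f gi : nat -> R -> C) (u : R -> C) (m : nat) :
  (forall x, I x -> cascade f 1 u x = dx (gi 2%N) x) ->
  (forall i x, (2 <= i <= m)%N -> I x -> f i x * dx (gi i) x = gi i.+1 x) ->
  (0 < m)%N ->
  forall x, I x -> cascade f m u x = dx (gi m.+1) x.
Proof.
move=> H1 Hi; elim: m Hi => [//|[|m] IHm] Hi _ x Ix; first exact: H1.
apply: dx_ext_loc; apply: filter_imp (itv_locally Ix) => y Iy.
change (f m.+2 y * cascade f m.+1 u y = gi m.+3 y).
rewrite IHm // => [|i z /andP[i2 im]].
  by apply: Hi => //; rewrite leqnn.
by apply: Hi; rewrite i2 leqW.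
Qed.
End Liouville.

Theorem proposition5p10 (k : nat) (hk : (4 <= k)%N)
  (I : ointerval) (x0 : R) (hx0 : I x0) (T : Type)
  (f : nat -> R -> C)
  (hf_smooth : forall i : nat, (1 <= i <= k - 1)%N -> smooth_on I (f i))
  (hf_neq0 : forall (i : nat) (x : R), (1 <= i <= k - 1)%N -> I x ->
     f i x <> RtoC 0)
  (g : R -> T -> C)
  (gi : nat -> R -> T -> C)
  (Rf G : R -> T -> C)
  (hg_smooth : forall t : T, smooth_on I (fun x => g x t))
  (hgi_smooth : forall (i : nat) (t : T), (2 <= i <= k - 2)%N ->
     smooth_on I (fun x => gi i x t))
  (hRf_smooth : forall t : T, smooth_on I (fun x => Rf x t))
  (hG_smooth : forall t : T, smooth_on I (fun x => G x t))
  (hG : forall (x : R) (t : T), I x -> dx (fun y => G y t) x = g x t)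
  (hRf : forall (x : R) (t : T), I x ->
     Cmult (f (k - 1)%N x) (dx (fun y => Rf y t) x) = G x t)
  (hgi_last : forall (x : R) (t : T), I x ->
     Cmult (f (k - 2)%N x) (dx (fun y => gi (k - 2)%N y t) x) = Rf x t)
  (hgi : forall (i : nat) (x : R) (t : T), (2 <= i <= k - 3)%N -> I x ->
     Cmult (f i x) (dx (fun y => gi i y t) x) = gi i.+1 x t)
  (hL : forall t : T,
     liouville_condition I (fun x => Cdiv (gi 2%N x t) (f 1%N x))) :
  let ubar (x : R) (t : T) : C :=
    @RInt C_R_CompleteNormedModule (fun s => Cdiv (gi 2%N s t) (f 1%N s)) x0 x in
  forall t : T,
    elementary_on I (fun x => ubar x t) /\
    solves_on I f (k - 1)%N (fun x => g x t) (fun x => ubar x t).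
Proof.
move=> ubar t.
have [eu du] := liouville_integral (hL t) hx0.
split=> //; split; first by case: eu.
case: k hk hf_smooth hf_neq0 hgi_smooth hRf hgi_last hgi => [|[|[|[|n]]]] // _.
rewrite !subSS !subn0 => Hf Hf0 Hgi HR Hlast Hstep.
(* Here k = n + 4: the chain of the gi stops at index n + 2, and the last two
   derivatives of the cascade act on Rf and then on G. *)
have c1 x : I x -> cascade f 1 (ubar^~ t) x = dx (fun y => gi 2%N y t) x.
  move=> Ix; apply: dx_ext_loc; apply: filter_imp (itv_locally Ix) => y Iy /=.
  rewrite (dx_unique (du _ Iy)); field.
  exact: Hf0.
have c2 := cascade_telescope (gi := fun i x => gi i x t) (m := n.+1) c1.
have c3 x : I x -> cascade f n.+2 (ubar^~ t) x = dx (Rf^~ t) x.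
  move=> Ix; apply: dx_ext_loc; apply: filter_imp (itv_locally Ix) => y Iy.
  change (f n.+2 y * cascade f n.+1 (ubar^~ t) y = Rf y t)%C.
  by rewrite c2 //; [exact: Hlast | move=> i z Hi Iz; apply: Hstep].
move=> x Ix; rewrite -hG //.
apply: dx_ext_loc; apply: filter_imp (itv_locally Ix) => y Iy.
change (f n.+3 y * cascade f n.+2 (ubar^~ t) y = G y t)%C.
by rewrite c3 //; apply: HR.
Qed.
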